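(* Let $H=(V,E)$ be a directed $k$-uniform hypergraph and let $S\subseteq V$. Let $\Psi=E\cup\{(v,\dots,v):v\in V\}$ and $\Phi=\{(v,\dots,v):v\in S\}$, and suppose that $\Psi\unrhd\Phi$. Then $\Theta(H)\geq |S|$.
   Context: A directed $k$-uniform hypergraph is a pair $H=(V,E)$ with $V$ a finite set and $E$ a set of $k$-tuples of elements of $V$. The strong product $G\boxtimes H$ has vertex set $V_G\times V_H$, and $((g_1,h_1),\dots,(g_k,h_k))$ is an edge iff either ($g_1=\dots=g_k$ and $(h_1,\dots,h_k)\in E_H$), or ($(g_1,\dots,g_k)\in E_G$ and $h_1=\dots=h_k$), or ($(g_1,\dots,g_k)\in E_G$ and $(h_1,\dots,h_k)\in E_H$). $H^{\boxtimes n}$ is the $n$-fold strong product. An independent set is $S\subseteq V$ such that no edge has all coordinates in $S$; $\alpha(H)$ is the maximum size of an independent set; $\Theta(H)=\lim_{n\to\infty}\alpha(H^{\boxtimes n})^{1/n}$. Combinatorial degeneration: for finite sets $I_1,\dots,I_k$ and $\Phi\subseteq\Psi\subseteq I_1\times\dots\times I_k$, $\Psi\unrhd\Phi$ means there are maps $u_i:I_i\to\mathbb{Z}$ ($i\in[k]$) such that for every $x=(x_1,\dots,x_k)\in\Psi\setminus\Phi$, $\sum_{i=1}^k u_i(x_i)>0$, and for every $x\in\Phi$, $\sum_{i=1}^k u_i(x_i)=0$.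
   Formalization: The formal statement additionally assumes that no constant tuple (v,…,v) with v in S is an edge of H; without this the claim fails, e.g. V=S={v}, E={(v,…,v)}, where the degeneration holds trivially with u=0 but Θ(H)=0<1. *)

(* Defs.v *)
From HB Require Import structures.
From mathcomp Require Import all_boot all_order all_algebra.
From mathcomp Require Import all_classical all_reals all_analysis.

Set Implicit Arguments.
Unset Strict Implicit.
Unset Printing Implicit Defensive.

Import Order.TTheory GRing.Theory Num.Theory.
Import numFieldNormedType.Exports.

Local Open Scope ring_scope.

Record dhypergraph (k : nat) := DHypergraph {
  vertex : finType;
  edges : {set {ffun 'I_k -> vertex}}
}.

Definition const_tuple (k : nat) (V : finType) (v : V) : {ffun 'I_k -> V} :=
  [ffun=> v].

(* g_1 = ... = g_k, stated pairwise so that it also makes sense for k = 0 *)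
Definition all_equal (k : nat) (V : finType) (g : {ffun 'I_k -> V}) : bool :=
  [forall i, forall j, g i == g j].

Definition strong_product (k : nat) (G H : dhypergraph k) : dhypergraph k :=
  @DHypergraph k (vertex G * vertex H)%type
    [set e : {ffun 'I_k -> vertex G * vertex H} |
      let g := [ffun i => (e i).1] in
      let h := [ffun i => (e i).2] in
      [|| all_equal g && (h \in edges H),
          (g \in edges G) && all_equal h
        | (g \in edges G) && (h \in edges H)]].

Definition one_vertex (k : nat) : dhypergraph k :=
  @DHypergraph k unit finset.set0.

(* iterop: H for n = 1, H ⊠ (... ⊠ H) with n factors for n > 1; the empty
   product (n = 0) is the neutral element, a single vertex without edges *)
Definition strong_power (k : nat) (H : dhypergraph k) (n : nat) : dhypergraph k :=
  iterop n (@strong_product k) H (one_vertex k).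

Definition independent (k : nat) (H : dhypergraph k) (A : {set vertex H}) : bool :=
  [forall e in edges H, ~~ [forall i, e i \in A]].

Definition alpha (k : nat) (H : dhypergraph k) : nat :=
  (\max_(A : {set vertex H} | independent A) #|A|)%N.

Definition Theta (R : realType) (k : nat) (H : dhypergraph k) : R :=
  limn (fun n : nat => (alpha (strong_power H n))%:R `^ n%:R^-1 : R).

Definition comb_degeneration (k : nat) (I : 'I_k -> finType)
    (Psi Phi : {set {dffun forall i : 'I_k, I i}}) : Prop :=
  Phi \subset Psi /\
  exists u : forall i : 'I_k, I i -> int,
    (forall x, x \in Psi :\: Phi -> 0 < \sum_(i < k) u i (x i)) /\
    (forall x, x \in Phi -> \sum_(i < k) u i (x i) = 0).

(* Main.v *)
Require Import Defs.
From mathcomp Require Import all_boot all_order all_algebra.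
From mathcomp Require Import all_classical all_reals all_analysis.
From mathcomp Require Import ring lra zify.

Set Implicit Arguments.
Unset Strict Implicit.
Unset Printing Implicit Defensive.

Import Order.TTheory GRing.Theory Num.Theory.
Import numFieldNormedType.Exports.

Local Open Scope ring_scope.

(** The weights [u_i] of the degeneration add up along strong products: on the
    [n]-th power, tuples of words in [S^n] that are edges have positive total
    weight and constant tuples have weight zero. Hence the words of [S^n] with a
    prescribed weight profile [(u_1(w), ..., u_k(w))] form an independent set.
    There are at most [(2Mn+1)^k] profiles, so by pigeonhole
    [|S|^n <= alpha(H^n) (2Mn+1)^k], and the polynomial factor disappears in the
    limit of [n]-th roots. That limit exists by Fekete's lemma applied to
    [ln alpha(H^n)], which is superadditive; if [alpha(H) = 0], then
    [alpha(H^n) = 0] for all [n >= 1] and [S] is empty. *)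

(** * Independent sets and strong products *)

Lemma independentP (k : nat) (G : dhypergraph k) (A : {set vertex G}) :
  reflect (forall e, e \in edges G -> (forall i, e i \in A) -> False)
          (independent A).
Proof.
apply: (iffP forallP) => [indA e eG eA|indA e].
  by move: (indA e); rewrite eG => /negP; apply; apply/forallP.
apply/implyP => eG; apply/negP => /forallP; exact: indA.
Qed.

Lemma leq_card_alpha (k : nat) (G : dhypergraph k) (A : {set vertex G}) :
  independent A -> (#|A| <= alpha G)%N.
Proof.
by move=> indA; apply: (@bigop.leq_bigmax_cond _ _ (fun A => #|pred_of_set A|)).
Qed.

Lemma alpha_leq (k : nat) (G : dhypergraph k) (m : nat) :
  (forall A : {set vertex G}, independent A -> (#|A| <= m)%N) ->
  (alpha G <= m)%N.
Proof. by move=> indm; apply/bigmax_leqP. Qed.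

Lemma alpha_witness (k : nat) (G : dhypergraph k) :
  (0 < alpha G)%N -> exists2 A : {set vertex G}, independent A & #|A| = alpha G.
Proof.
move=> a_gt0; have [A indA|] := pickP (@independent k G); last first.
  by move=> no; move: a_gt0; rewrite /alpha big1 // => A; rewrite no.
rewrite /alpha (bigop.bigmax_eq_arg A) //.
by case: arg_maxnP => // B indB _; exists B.
Qed.

(** A truth table turns the three cases of the definition into a symmetric form: each projection is
    constant or an edge, and at least one is an edge. *)
Lemma strong_product_edge (k : nat) (G H : dhypergraph k)
    (e : {ffun 'I_k -> vertex (strong_product G H)}) :
  let g := [ffun i => (e i).1] in
  let h := [ffun i => (e i).2] in
  (e \in edges (strong_product G H)) =
  [&& all_equal g || (g \in edges G), all_equal h || (h \in edges H)
    & (g \in edges G) || (h \in edges H)].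
Proof.
move=> g h; rewrite inE /= -/g -/h.
by case: (all_equal g); case: (all_equal h); case: (g \in _); case: (h \in _).
Qed.

Lemma all_equalP (k : nat) (V : finType) (g : {ffun 'I_k -> V}) :
  reflect (forall i j, g i = g j) (all_equal g).
Proof.
apply: (iffP forallP) => [eg i j|eg i]; first by apply/eqP; exact: (forallP (eg i)).
by apply/forallP => j; apply/eqP.
Qed.

(** A product of independent sets is independent, because an edge of the product projects to an edge
    in at least one factor. *)
Lemma alpha_strong_product (k : nat) (G H : dhypergraph k) :
  (alpha G * alpha H <= alpha (strong_product G H))%N.
Proof.
have [->//|/alpha_witness[A indA <-]] := posnP (alpha G).
have [->|/alpha_witness[B indB <-]] := posnP (alpha H); first by rewrite muln0.
rewrite -cardsX; apply: leq_card_alpha; apply/independentP => e.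
rewrite strong_product_edge => /and3P[_ _ /orP[]] eE eAB.
- apply: (independentP _ indA _ eE) => i; rewrite ffunE.
  by have := eAB i; rewrite inE => /andP[].
- apply: (independentP _ indB _ eE) => i; rewrite ffunE.
  by have := eAB i; rewrite inE => /andP[].
Qed.

(** If [(v, w)] lies in an independent set, then [v] carries no loop: paired with the constant [w],
    a loop would become an edge on [(v, w)]. So [{v}] is independent. *)
Lemma alpha_strong_product_gt0 (k : nat) (G H : dhypergraph k) :
  (0 < alpha (strong_product G H))%N -> (0 < alpha G)%N.
Proof.
move=> a_gt0; have [A indA cA] := alpha_witness a_gt0.
have /card_gt0P[[v w] vwA] : (0 < #|A|)%N by rewrite cA.
rewrite -(cards1 v); apply: leq_card_alpha; apply/independentP => e eG ev.
have fst_e : [ffun i => ([ffun i : 'I_k => (e i, w)] i).1] = e.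
  by apply/ffunP => i; rewrite !ffunE.
apply: (independentP _ indA [ffun i => (e i, w)]) => [|i].
  rewrite strong_product_edge fst_e eG orbT /= andbT; apply/orP; left.
  by apply/all_equalP => i j; rewrite !ffunE.
by have := ev i; rewrite inE ffunE => /eqP ->.
Qed.

(** * Edge-reflecting injections and associativity *)

Definition embeds (k : nat) (G G' : dhypergraph k) : Prop :=
  exists2 f : vertex G -> vertex G', injective f &
    forall e : {ffun 'I_k -> vertex G},
      [ffun i => f (e i)] \in edges G' -> e \in edges G.

(** The image of an independent set is independent: an edge inside the image lifts, coordinate by
    coordinate, to an edge inside the original set. *)
Lemma embeds_alpha (k : nat) (G G' : dhypergraph k) :
  embeds G G' -> (alpha G <= alpha G')%N.
Proof.
move=> [f f_inj fE]; apply: alpha_leq => A indA.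
rewrite -(card_imset _ f_inj); apply: leq_card_alpha.
apply/independentP => e' e'G e'A.
have /fin_all_exists[g gE] : forall i, exists x, x \in A /\ e' i = f x.
  by move=> i; have /imsetP[x xA ->] := e'A i; exists x.
apply: (independentP _ indA [ffun i => g i]) => [|i]; last first.
  by rewrite ffunE; case: (gE i).
apply: fE; suff -> : [ffun i => f ([ffun i0 => g i0] i)] = e' by [].
by apply/ffunP => i; rewrite !ffunE; case: (gE i).
Qed.

Lemma embeds_trans (k : nat) (G1 G2 G3 : dhypergraph k) :
  embeds G1 G2 -> embeds G2 G3 -> embeds G1 G3.
Proof.
move=> [f f_inj fE] [g g_inj gE]; exists (g \o f); first exact: inj_comp.
move=> e eE; apply: fE; apply: gE.
suff <- : [ffun i => (g \o f) (e i)] = [ffun i => g ([ffun j => f (e j)] i)].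
  by [].
by apply/ffunP => i; rewrite !ffunE.
Qed.

Lemma embeds_strong_product (k : nat) (H G G' : dhypergraph k) :
  embeds G G' -> embeds (strong_product H G) (strong_product H G').
Proof.
move=> [f f_inj fE].
exists (fun x : vertex (strong_product H G) =>
          (x.1, f x.2) : vertex (strong_product H G')).
  by move=> [x y] [x' y'] [-> /f_inj ->].
move=> e; rewrite !strong_product_edge.
have -> : [ffun i => ([ffun i0 => ((e i0).1, f (e i0).2)] i).1] =
          [ffun i => (e i).1] by apply/ffunP => i; rewrite !ffunE.
have -> : [ffun i => ([ffun i0 => ((e i0).1, f (e i0).2)] i).2] =
          [ffun i => f ([ffun i0 => (e i0).2] i)].
  by apply/ffunP => i; rewrite !ffunE.
set g := [ffun i => (e i).1]; set h := [ffun i => (e i).2].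
(* Injectivity lets constancy be pulled back along [f], just as [fE] does for edges. *)
have aeh : all_equal [ffun i => f (h i)] -> all_equal h.
  move=> /all_equalP hE; apply/all_equalP => i j; apply: f_inj.
  by have := hE i j; rewrite !ffunE.
case/and3P => -> /=.
case/orP => [/aeh ->|/fE ->]; rewrite ?orbT //=.
by case/orP => [->//|/fE ->]; rewrite orbT.
Qed.

(** Under either bracketing, an edge means that each of the three projections is constant or an edge
    and at least one is an edge. *)
Lemma strong_product_assoc_embeds (k : nat) (G H K : dhypergraph k) :
  embeds (strong_product (strong_product G H) K)
         (strong_product G (strong_product H K)).
Proof.
pose f (x : vertex (strong_product (strong_product G H) K)) :
  vertex (strong_product G (strong_product H K)) := (x.1.1, (x.1.2, x.2)).
exists f; first by move=> [[x y] z] [[x' y'] z'] [-> -> ->].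
move=> e; rewrite !strong_product_edge.
set g := [ffun i => (e i).1.1]; set h := [ffun i => (e i).1.2].
set l := [ffun i => (e i).2].
have -> : [ffun i => ([ffun i0 => f (e i0)] i).1] = g.
  by apply/ffunP => i; rewrite !ffunE.
have -> : [ffun i => ([ffun i0 => ([ffun i1 => f (e i1)] i0).2] i).1] = h.
  by apply/ffunP => i; rewrite !ffunE.
have -> : [ffun i => ([ffun i0 => ([ffun i1 => f (e i1)] i0).2] i).2] = l.
  by apply/ffunP => i; rewrite !ffunE.
have -> : [ffun i => ([ffun i0 => (e i0).1] i).1] = g.
  by apply/ffunP => i; rewrite !ffunE.
have -> : [ffun i => ([ffun i0 => (e i0).1] i).2] = h.
  by apply/ffunP => i; rewrite !ffunE.
have ae_pair : all_equal [ffun i => (e i).1] = all_equal g && all_equal h.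
  apply/all_equalP/andP => [E1|[/all_equalP E1 /all_equalP E2] i j].
    by split; apply/all_equalP => i j; have := E1 i j; rewrite !ffunE => ->.
  have := E1 i j; have := E2 i j; rewrite !ffunE.
  by case: (e i).1 (e j).1 => [a b] [c d] /= -> ->.
have ae_pair2 : all_equal [ffun i => ([ffun i0 => f (e i0)] i).2] =
                all_equal h && all_equal l.
  apply/all_equalP/andP => [E1|[/all_equalP E1 /all_equalP E2] i j].
    by split; apply/all_equalP => i j; have := E1 i j; rewrite !ffunE => -[].
  by have := E1 i j; have := E2 i j; rewrite !ffunE => /= -> ->.
rewrite ae_pair ae_pair2.
by case: (all_equal g); case: (all_equal h); case: (all_equal l);
   case: (g \in _); case: (h \in _); case: (l \in _).
Qed.

(** * Independence numbers of strong powers *)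

Lemma strong_powerSS (k : nat) (H : dhypergraph k) (n : nat) :
  strong_power H n.+2 = strong_product H (strong_power H n.+1).
Proof. by []. Qed.

Lemma strong_powerD_embeds (k : nat) (H : dhypergraph k) (m n : nat) :
  embeds (strong_product (strong_power H m.+1) (strong_power H n.+1))
         (strong_power H (m.+1 + n.+1)).
Proof.
elim: m => [|m IHm].
  (* The first power is [H] itself, so both sides agree by computation. *)
  exists id => // e; suff -> : [ffun i => id (e i)] = e by [].
  by apply/ffunP => i; rewrite ffunE.
rewrite !addSn addnS !strong_powerSS.
apply: embeds_trans (strong_product_assoc_embeds _ _ _) _.
by apply: embeds_strong_product; move: IHm; rewrite addSn addnS.
Qed.

Lemma alpha_strong_powerD (k : nat) (H : dhypergraph k) (m n : nat) :
  (0 < m)%N -> (0 < n)%N ->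
  (alpha (strong_power H m) * alpha (strong_power H n)
     <= alpha (strong_power H (m + n)))%N.
Proof.
case: m n => [//|m] [//|n] _ _.
apply: leq_trans (alpha_strong_product _ _) _.
exact/embeds_alpha/strong_powerD_embeds.
Qed.

Lemma alpha_strong_power_gt0 (k : nat) (H : dhypergraph k) (n : nat) :
  (0 < alpha H)%N -> (0 < alpha (strong_power H n.+1))%N.
Proof.
move=> a_gt0; elim: n => [//|n IHn].
by apply: leq_trans (alpha_strong_product _ _); rewrite muln_gt0 a_gt0.
Qed.

Lemma alpha_strong_power_eq0 (k : nat) (H : dhypergraph k) (n : nat) :
  alpha H = 0%N -> alpha (strong_power H n.+1) = 0%N.
Proof.
case: n => [//|n] aH0; apply/eqP; rewrite -leqn0 leqNgt; apply/negP.
by move/alpha_strong_product_gt0; rewrite aH0.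
Qed.

Lemma alpha_strong_power_le (k : nat) (H : dhypergraph k) (n : nat) :
  (alpha (strong_power H n.+1) <= #|vertex H| ^ n.+1)%N.
Proof.
have <- : #|vertex (strong_power H n.+1)| = (#|vertex H| ^ n.+1)%N.
  by elim: n => [|n IHn]; rewrite ?expn1 // strong_powerSS card_prod IHn -expnS.
by apply: alpha_leq => A _; exact: max_card.
Qed.

(** * Weights along strong products and the pigeonhole bound *)

(* A weighted form of the degeneration hypothesis that is stable under strong
   products; [M] bounds the weights, hence the number of weight profiles. *)
Definition graded (k : nat) (G : dhypergraph k) (S : {set vertex G})
    (u : 'I_k -> vertex G -> int) (M : nat) : Prop :=
  [/\ forall v, v \in S -> \sum_(i < k) u i v = 0,
      forall e, e \in edges G -> (forall i, e i \in S) ->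
        0 < \sum_(i < k) u i (e i)
    & forall i v, `|u i v| <= M%:Z].

Lemma graded_sum_all_equal (k : nat) (G : dhypergraph k) (S : {set vertex G})
    (u : 'I_k -> vertex G -> int) (M : nat) (e : {ffun 'I_k -> vertex G}) :
  graded S u M -> (forall i, e i \in S) -> all_equal e ->
  \sum_(i < k) u i (e i) = 0.
Proof.
(* For [k = 0] no coordinate names the common vertex, but the sum is empty. *)
case=> uS _ _ eS /all_equalP ee; case: k => [|k] in G S u e uS eS ee *.
  by rewrite big_ord0.
apply: etrans (uS (e ord0) (eS _)).
by apply: eq_bigr => i _; rewrite (ee i ord0).
Qed.

(** With added weights, each projection of an edge inside [S] times [T] contributes zero if constant
    and a positive amount if an edge; at least one is an edge. *)
Lemma graded_product (k : nat) (G H : dhypergraph k)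
    (S : {set vertex G}) (T : {set vertex H}) u w (M N : nat) :
  graded S u M -> graded T w N ->
  @graded k (strong_product G H) (finset.setX S T)
    (fun i x => u i x.1 + w i x.2) (M + N).
Proof.
move=> gS gT; have [uS uE uM] := gS; have [wT wE wN] := gT; split.
- by move=> [x y]; rewrite inE => /andP[/= xS yT]; rewrite big_split /= uS // wT.
- move=> e; rewrite strong_product_edge => eE eST.
  rewrite big_split /=.
  set g := [ffun i => (e i).1] in eE; set h := [ffun i => (e i).2] in eE.
  have gS' i : g i \in S by rewrite ffunE; have := eST i; rewrite inE => /andP[].
  have hT' i : h i \in T by rewrite ffunE; have := eST i; rewrite inE => /andP[].
  have -> : \sum_(i < k) u i (e i).1 = \sum_(i < k) u i (g i).
    by apply: eq_bigr => i _; rewrite ffunE.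
  have -> : \sum_(i < k) w i (e i).2 = \sum_(i < k) w i (h i).
    by apply: eq_bigr => i _; rewrite ffunE.
  have g_ge0 : all_equal g || (g \in edges G) -> 0 <= \sum_(i < k) u i (g i).
    case/orP => [ag|gE]; last exact/ltW/uE.
    by rewrite (graded_sum_all_equal gS).
  have h_ge0 : all_equal h || (h \in edges H) -> 0 <= \sum_(i < k) w i (h i).
    case/orP => [ah|hE]; last exact/ltW/wE.
    by rewrite (graded_sum_all_equal gT).
  case/and3P: eE => /g_ge0 g0 /h_ge0 h0 /orP[gE|hE].
    by apply: ltr_wpDr => //; exact: uE.
  by apply: ltr_wpDl => //; exact: wE.
- move=> i [x y] /=; apply: le_trans (ler_normD _ _) _.
  by rewrite PoszD lerD.
Qed.

(** The weight bound grows only linearly in the exponent, which keeps the number of profiles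
    polynomial. *)
Lemma graded_power (k : nat) (H : dhypergraph k) (S : {set vertex H}) u M n :
  graded S u M ->
  exists (T : {set vertex (strong_power H n.+1)}) w,
    #|T| = (#|S| ^ n.+1)%N /\ graded T w (M * n.+1).
Proof.
move=> gS; elim: n => [|n [T [w [cT gT]]]].
  by exists S, u; rewrite muln1 expn1.
exists (finset.setX S T), (fun i x => u i x.1 + w i x.2).
rewrite cardsX cT -expnS mulnS; split => //.
exact: graded_product gS gT.
Qed.

Lemma card_le_fiber (T F : finType) (S : {set T}) (f : T -> F) (b : nat) :
  (forall y, (#|[set x in S | f x == y]| <= b)%N) -> (#|S| <= b * #|F|)%N.
Proof.
move=> fib; rewrite -sum1_card (partition_big f xpredT) //=.
rewrite mulnC -sum_nat_const; apply: leq_sum => y _.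
rewrite sum1_card; apply: leq_trans (fib y); apply: eq_leq.
by apply: eq_card => x; rewrite inE.
Qed.

(* A set of vertices of [S] sharing the same weight profile is independent: an
   edge inside it would have the weight of a constant tuple, which is zero. *)
Lemma graded_card (k : nat) (G : dhypergraph k) (S : {set vertex G}) u M :
  graded S u M -> (#|S| <= alpha G * (2 * M).+1 ^ k)%N.
Proof.
move=> gS; have [uS uE uM] := gS.
(* Shifting by [M] moves the weights from [-M, M] into [0, 2M], so [absz] and [inord] lose no
   information. *)
pose profile (v : vertex G) : {ffun 'I_k -> 'I_(2 * M).+1} :=
  [ffun i => inord (absz (u i v + M%:Z))].
have -> : ((2 * M).+1 ^ k = #|{: {ffun 'I_k -> 'I_(2 * M).+1}}|)%N.
  by rewrite card_ffun !card_ord.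
apply: (card_le_fiber (f := profile)) => y; apply: leq_card_alpha.
apply/independentP => e eE eA.
have eS i : e i \in S by have := eA i; rewrite inE => /andP[].
have ep i : profile (e i) = y by have := eA i; rewrite inE => /andP[_ /eqP].
have profile_inj v w i : profile v = profile w -> u i v = u i w.
  move=> /ffunP/(_ i); rewrite !ffunE => /(congr1 val) /=.
  have := uM i v; have := uM i w.
  move=> h1 h2; rewrite !inordK; lia.
have := uE e eE eS.
have [k0|k_gt0] := posnP k.
  by rewrite big1 // => -[i lt_ik]; exfalso; move: lt_ik; rewrite k0.
pose i0 := Ordinal k_gt0.
have -> : \sum_(i < k) u i (e i) = \sum_(i < k) u i (e i0).
  by apply: eq_bigr => i _; apply: profile_inj; rewrite !ep.
by rewrite uS // ltxx.
Qed.

Lemma comb_degeneration_graded (k : nat) (H : dhypergraph k)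
    (S : {set vertex H}) :
  (forall v, v \in S -> const_tuple k v \notin edges H) ->
  comb_degeneration (I := fun=> vertex H)
    (edges H :|: [set const_tuple k v | v : vertex H])
    [set const_tuple k v | v in S] ->
  exists u M, graded S u M.
Proof.
move=> hloop [_ [u [u_gt0 u_eq0]]].
exists u, (\max_(p : 'I_k * vertex H) `|u p.1 p.2|)%N; split.
- move=> v vS; rewrite -[RHS](u_eq0 (const_tuple k v)); last exact: imset_f.
  by apply: eq_bigr => i _; rewrite ffunE.
- move=> e eE _; apply: u_gt0; rewrite !inE eE andbT.
  (* An edge in [Phi] would be a loop at a vertex of [S], excluded by [hloop]. *)
  by apply/imsetP => -[v vS ev]; have := hloop v vS; rewrite -ev eE.
- move=> i v; rewrite -abszE lez_nat.
  exact: (@bigop.leq_bigmax _ (fun p : 'I_k * vertex H => `|u p.1 p.2|%N) (i, v)).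
Qed.

(** * Fekete's lemma and polynomial factors *)

Lemma superadditive_mul (R : realType) (c : nat -> R) (m q : nat) :
  (forall m n, (0 < m)%N -> (0 < n)%N -> c m + c n <= c (m + n)%N) ->
  (0 < m)%N -> q.+1%:R * c m <= c (q.+1 * m)%N.
Proof.
move=> cD m_gt0; elim: q => [|q IHq]; first by rewrite mul1r mul1n.
rewrite mulSn -natr1 mulrDl mul1r addrC.
by apply: le_trans (cD _ _ _ _); rewrite ?muln_gt0 ?lerD2l.
Qed.

(** The limit is the supremum. Choose [m] with [c m / m] close to it and divide [n] by [m] with
    remainder: superadditivity and nonnegativity bound the loss by [c m / n]. *)
Lemma fekete (R : realType) (c : nat -> R) (B : R) :
  (forall n, (0 < n)%N -> 0 <= c n) ->
  (forall m n, (0 < m)%N -> (0 < n)%N -> c m + c n <= c (m + n)%N) ->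
  (forall n, (0 < n)%N -> c n / n%:R <= B) ->
  exists2 L : R, (forall n, (0 < n)%N -> c n / n%:R <= L) &
    (c n / n%:R @[n --> \oo] --> L)%classic.
Proof.
move=> c_ge0 cD cB.
pose E : set R := [set x | exists2 n, (0 < n)%N & x = c n / n%:R]%classic.
have supE : has_sup E.
  split; first by exists (c 1%N / 1%:R), 1%N.
  by exists B => _ [n n_gt0 ->]; exact: cB.
have cL n : (0 < n)%N -> c n / n%:R <= sup E.
  by move=> n_gt0; apply: sup_upper_bound => //; exists n.
exists (sup E) => //; apply/cvgrPdist_le => eps eps_gt0.
have eps2 : 0 < eps / 2 by rewrite divr_gt0.
have [_ [m m_gt0 ->] lt_m] := sup_adherent eps2 supE.
have lower q r : (r < m)%N ->
    c m / m%:R - c m / (q.+1 * m + r)%:R <= c (q.+1 * m + r)%N / (q.+1 * m + r)%:R.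
  move=> r_lt; set n := (q.+1 * m + r)%N.
  have n_gt0 : (0 < n)%N by rewrite /n; nia.
  have nR : 0 < n%:R :> R by rewrite ltr0n.
  have mR : 0 < m%:R :> R by rewrite ltr0n.
  have le1 : q.+1%:R * c m <= c n.
    apply: le_trans (superadditive_mul q cD m_gt0) _.
    rewrite /n; case: (r) => [|r']; first by rewrite addn0.
    apply: le_trans (cD _ _ _ _); rewrite ?muln_gt0 ?m_gt0 //.
    by rewrite lerDl c_ge0.
  (* After multiplying by [n], the claim follows from n <= (q+2)m. *)
  rewrite ler_pdivlMr // mulrBl divfK ?gt_eqF // lerBlDr.
  apply: le_trans (lerD le1 (lexx _)).
  have -> : q.+1%:R * c m + c m = c m / m%:R * (q.+2 * m)%:R.
    by rewrite natrM -[q.+2%:R]natr1; field; rewrite gt_eqF.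
  rewrite ler_wpM2l ?divr_ge0 ?c_ge0 ?(ltW mR) // ler_nat /n; nia.
(* Beyond [N] the loss [c m / n] is at most [eps / 2]; n >= m makes the quotient positive. *)
pose N := (Num.trunc (c m / (eps / 2))).+1.
have := nbhs_infty_ge (maxn N m); apply: filterS => n n_ge.
have n_gt0 : (0 < n)%N by lia.
have nR : 0 < n%:R :> R by rewrite ltr0n.
rewrite ger0_norm ?subr_ge0 ?cL //.
have nE : n = ((n %/ m).-1.+1 * m + n %% m)%N.
  rewrite prednK; first exact: divn_eq.
  by rewrite divn_gt0 //; lia.
have := lower (n %/ m).-1 (n %% m)%N; rewrite -nE ltn_pmod // => /(_ isT).
have : c m / n%:R <= eps / 2.
  rewrite ler_pdivrMr // mulrC -ler_pdivrMr //.
  apply: ltW; apply: lt_le_trans (truncnS_gt _) _.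
  by rewrite ler_nat -/N; lia.
move: lt_m; lra.
Qed.

Lemma le_of_polynomial_loss (R : realType) (x L : R) (k M : nat) :
  (forall n, (0 < n)%N ->
     n%:R * x <= n%:R * L + k%:R * ln (2 * (M * n)).+1%:R) ->
  x <= L.
Proof.
move=> xL; rewrite leNgt; apply/negP => Lx.
have d_gt0 : 0 < x - L by rewrite subr_gt0.
(* At n = j^2 the logarithmic term is at most [j * C], while [j] is chosen so that j^2 (x - L)
   exceeds it. *)
pose C : R := 2 * k%:R * (2 * M).+1%:R.
pose j := (Num.trunc (C / (x - L))).+1.
have jC : C < j%:R * (x - L) by rewrite -ltr_pdivrMr // truncnS_gt.
have jR : 0 < j%:R :> R by rewrite ltr0n.
have j2_gt0 : (0 < j ^ 2)%N by rewrite expn_gt0.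
(* [2 M j^2 + 1 <= ((2 M + 1) j)^2], so [ln x < x] gives a bound linear in [j] *)
have ln_le : ln (2 * (M * j ^ 2)).+1%:R <= 2 * ((2 * M).+1%:R * j%:R) :> R.
  have -> : 2 * ((2 * M).+1%:R * j%:R) = (((2 * M).+1 * j)%:R : R) *+ 2.
    by rewrite natrM mulr_natl.
  apply: le_trans (_ : ln ((((2 * M).+1 * j)%:R : R) ^+ 2) <= _).
    rewrite ler_ln ?posrE ?exprn_gt0 ?ltr0n ?muln_gt0 //.
    by rewrite -natrX ler_nat; nia.
  rewrite lnXn ?ltr0n ?muln_gt0 // lerMn2r /=.
  by apply/ltW/ln_sublinear; rewrite ltr0n muln_gt0.
have : j%:R * (j%:R * (x - L)) <= j%:R * C.
  have := xL _ j2_gt0; rewrite natrX expr2 => h.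
  have := ler_wpM2l (ler0n R k) ln_le; rewrite /C; lra.
by rewrite ler_pM2l // leNgt jC.
Qed.

(** * The limit defining the capacity, and the conclusion *)

Lemma Theta_alpha0 (R : realType) (k : nat) (H : dhypergraph k) :
  alpha H = 0%N -> Theta R H = 0.
Proof.
move=> aH0; rewrite /Theta; apply: cvg_lim => //.
apply: (cvg_trans _ (@cvg_cst R 0 nat \oo%classic _)).
(* Restricting to n >= 1 makes the exponent nonzero; zero to the power zero would be 1. *)
apply: near_eq_cvg; have := nbhs_infty_ge 1%N; apply: filterS => -[//|n] _.
by rewrite (alpha_strong_power_eq0 _ aH0) powR0 // invr_neq0 ?pnatr_eq0.
Qed.

(** Fekete's limit [L] is also an upper bound for every ln alpha(H^n) / n, so finite powers can be
    compared with it directly. *)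
Lemma Theta_log (R : realType) (k : nat) (H : dhypergraph k) :
  (0 < alpha H)%N ->
  exists2 L : R, Theta R H = expR L &
    forall n, (0 < n)%N -> ln (alpha (strong_power H n))%:R <= n%:R * L.
Proof.
move=> aH_gt0; pose a n := alpha (strong_power H n).
have a_gt0 n : (0 < n)%N -> 0 < (a n)%:R :> R.
  by case: n => [//|n] _; rewrite ltr0n alpha_strong_power_gt0.
have a_ge1 n : (0 < n)%N -> 1 <= (a n)%:R :> R.
  by case: n => [//|n] _; rewrite ler1n alpha_strong_power_gt0.
pose c n : R := ln (a n)%:R.
have c_ge0 n : (0 < n)%N -> 0 <= c n by move=> n0; apply: ln_ge0; exact: a_ge1.
have cD m n : (0 < m)%N -> (0 < n)%N -> c m + c n <= c (m + n)%N.
  move=> m0 n0; have mn0 : (0 < m + n)%N by rewrite addn_gt0 m0.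
  rewrite /c -lnM ?posrE ?a_gt0 // ler_ln ?posrE ?mulr_gt0 ?a_gt0 //.
  by rewrite -natrM ler_nat alpha_strong_powerD.
have cB n : (0 < n)%N -> c n / n%:R <= ln #|vertex H|%:R.
  move=> n0; have V_gt0 : (0 < #|vertex H|)%N.
    apply: leq_trans aH_gt0 _.
    by have := alpha_strong_power_le H 0; rewrite expn1.
  rewrite ler_pdivrMr ?ltr0n // mulr_natr -lnXn ?ltr0n // /c.
  rewrite ler_ln ?posrE ?a_gt0 ?exprn_gt0 ?ltr0n // -natrX ler_nat.
  by case: (n) n0 => [//|n'] _; exact: alpha_strong_power_le.
have [L cL cvgL] := fekete c_ge0 cD cB.
exists L; last first.
  by move=> n n0; rewrite -/(a n) -/(c n) mulrC -ler_pdivrMr ?ltr0n ?cL.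
rewrite /Theta; apply: cvg_lim => //.
apply: (cvg_trans _ (continuous_cvg _ (@continuous_expR R L) cvgL)).
apply: near_eq_cvg.
have := nbhs_infty_ge 1%N; apply: filterS => n n0 /=.
(* For a nonzero base, [powR] is the exponential of exponent times logarithm. *)
by rewrite /powR gt_eqF ?a_gt0 // mulrC.
Qed.

Theorem theorem2p15 (R : realType) (k : nat) (H : dhypergraph k)
    (S : {set vertex H})
    (hloop : forall v, v \in S -> const_tuple k v \notin edges H)
    (hdeg : comb_degeneration (I := fun=> vertex H)
       (edges H :|: [set const_tuple k v | v : vertex H])
       [set const_tuple k v | v in S]) :
  #|S|%:R <= Theta R H.
Proof.
have [u [M gS]] := comb_degeneration_graded hloop hdeg.
have [aH0|aH_gt0] := posnP (alpha H).
  by have := graded_card gS; rewrite aH0 mul0n leqn0 (Theta_alpha0 R aH0) => /eqP ->.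
have [L -> aL] := Theta_log R aH_gt0.
have [->|S_gt0] := posnP #|S|; first exact: expR_ge0.
rewrite -[leLHS]lnK ?posrE ?ltr0n // ler_expR.
(* What remains is the logarithm of |S|^n <= alpha(H^n) (2Mn+1)^k, after bounding ln alpha(H^n) by
   nL. *)
apply: (@le_of_polynomial_loss R _ _ k M) => -[//|n] _.
have [T [w [cT gT]]] := graded_power n gS.
have a_gt0 := alpha_strong_power_gt0 n aH_gt0.
apply: le_trans (lerD (aL n.+1 isT) (lexx _)).
rewrite !mulr_natl -!lnXn ?ltr0n // -lnM ?posrE ?exprn_gt0 ?ltr0n //.
rewrite ler_ln ?posrE ?mulr_gt0 ?exprn_gt0 ?ltr0n //.
by rewrite -!natrX -natrM ler_nat -cT; exact: graded_card gT.
Qed.
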